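(* Consider a spherical 4-bar linkage with sector angles $\alpha=\beta=\gamma=\delta=\pi/2$ (a ''square''). (i) Finite solutions. There are two branches of flexes, each diffeomorphic to a circle $S^1$, with the parametrizations $$x\in\mathbb{R}\cup\{\infty\},\ y=0,\ z=x,\ w=0\qquad\text{or}\qquad x=0,\ y\in\mathbb{R}\cup\{\infty\},\ z=0,\ w=y,$$ i.e. the linkage is simply folded along collinear opposite creases. (ii) Solutions at infinity. The solutions at infinity correspond to two distinct branches of simple folds, each diffeomorphic to a circle $S^1$: $$x\in\mathbb{R}\cup\{\infty\},\ y\equiv\infty,\ z=-x,\ w\equiv\infty\qquad\text{or}\qquad x\equiv\infty,\ y\in\mathbb{R}\cup\{\infty\},\ z\equiv\infty,\ w=-y.$$
   Context: A spherical 4-bar linkage (equivalently, a degree-4 single-vertex rigid origami) is a closed chain of four great-circle arcs on the unit sphere with lengths (sector angles), in counter-clockwise cyclic order, $\alpha,\beta,\gamma,\delta\in(0,\pi)$. Its configuration is described by the folding angles (signed turning angles between consecutive arcs) $\rho_x,\rho_y,\rho_z,\rho_w\in\mathbb{R}/2\pi$, where $\rho_x$ is at the joint of $\alpha$ and $\beta$, $\rho_y$ of $\beta$ and $\gamma$, $\rho_z$ of $\gamma$ and $\delta$, $\rho_w$ of $\delta$ and $\alpha$. Write $x=\tan(\rho_x/2)$, $y=\tan(\rho_y/2)$, $z=\tan(\rho_z/2)$, $w=\tan(\rho_w/2)$, all in $\mathbb{R}\cup\{\infty\}$, the one-point compactification of the real line (folding angles $\pi$ and $-\pi$ are identified and correspond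 to $\infty$). Finite solutions are the flexes found with $x,y,z,w$ finite, each branch then being completed over $\mathbb{R}\cup\{\infty\}$; solutions at infinity are those with some of $x,y,z,w$ equal to $\infty$. *)

(* Defs.v *)
From mathcomp Require Import all_boot all_order all_algebra.
From mathcomp Require Import all_classical all_reals all_analysis.
Import Order.TTheory GRing.Theory Num.Theory.
Import numFieldNormedType.Exports.

Set Implicit Arguments.
Unset Strict Implicit.
Unset Printing Implicit Defensive.

Local Open Scope classical_set_scope.
Local Open Scope ring_scope.

Section Smooth.
Context {R : realType}.

(* C^k on a set U, meant for open U in finite-dimensional spaces. *)
Fixpoint Ck_on {V W : normedModType R} (k : nat) (U : set V) (f : V -> W) :
    Prop :=
  match k with
  | 0 => forall p, U p -> {for p, continuous f}
  | k'.+1 => (forall p, U p -> differentiable f p) /\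
             (forall v, Ck_on k' U (fun p => 'D_v f p))
  end.

(* Smoothness on an arbitrary subset X of a Euclidean space: near each point
   of X, f extends to a C^oo map on an open set of the ambient space. *)
Definition smooth_on {V W : normedModType R} (X : set V) (f : V -> W) : Prop :=
  forall p, X p -> exists (U : set V) (g : V -> W),
    [/\ open U, U p, forall k, Ck_on k U g &
        forall q, X q -> U q -> g q = f q].

Definition diffeomorphic {V W : normedModType R} (X : set V) (Y : set W) :
    Prop :=
  exists (f : V -> W) (g : W -> V),
    [/\ smooth_on X f /\ smooth_on Y g,
        forall p, X p -> Y (f p), forall q, Y q -> X (g q),
        {in X, cancel f g} & {in Y, cancel g f}].

(* The plane R x R carries the max norm; this affects neither its topology nor
   differentiability. *)
Definition circle : set (R * R)%type := [set p | p.1 ^+ 2 + p.2 ^+ 2 = 1].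

End Smooth.

Notation Rhat R := (one_point_compactification R).

(* The values (x, y, z, w) of the half-angle tangents. *)
Notation config R := (Rhat R * Rhat R * Rhat R * Rhat R)%type.

Section Linkage.
Context {R : realType}.

Definition fin (x : R) : Rhat R := Some x.
Definition infty : Rhat R := None.

Definition opp_hat (x : Rhat R) : Rhat R :=
  if x is Some r then fin (- r) else infty.

(* tan (rho / 2); as rho ranges over R / 2 pi this is a bijection onto Rhat. *)
Definition half_tan (rho : R) : Rhat R :=
  if cos (rho / 2) == 0 then infty else fin (tan (rho / 2)).

(* The state of a traveller along the chain is the orthonormal frame with
   columns (position on the sphere, unit tangent to the current arc, left
   normal).  Right multiplication by [arc a] advances it by length a along a
   great circle; by [turn rho], turns it by the signed angle rho on the spot. *)
Definition arc (a : R) : 'M[R]_3 :=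
  \matrix_(i, j) nth 0 (nth [::] [:: [:: cos a; - sin a; 0];
                                     [:: sin a;   cos a; 0];
                                     [:: 0;       0;     1]] i) j.

Definition turn (rho : R) : 'M[R]_3 :=
  \matrix_(i, j) nth 0 (nth [::] [:: [:: 1; 0;         0];
                                     [:: 0; cos rho; - sin rho];
                                     [:: 0; sin rho;   cos rho]] i) j.

Section SectorAngles.
Variables alpha beta gamma delta : R.

Definition closed_chain (rx ry rz rw : R) : Prop :=
  arc alpha *m turn rx *m arc beta *m turn ry
    *m arc gamma *m turn rz *m arc delta *m turn rw = 1%:M.

Definition solutions : set (config R) :=
  [set q | exists rx ry rz rw, closed_chain rx ry rz rw /\
     q = (half_tan rx, half_tan ry, half_tan rz, half_tan rw)].

Definition finite_config : set (config R) :=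
  [set q | let: (x, y, z, w) := q in
     [/\ x <> infty, y <> infty, z <> infty & w <> infty]].

Definition finite_solutions : set (config R) := solutions `&` finite_config.

Definition solutions_at_infinity : set (config R) :=
  solutions `&` ~` finite_config.

(* Creases are the rays from the centre of the sphere to the joints; here as
   unit vectors, in coordinates where alpha starts at e_0 with tangent e_1. *)
Definition crease_w : 'cV[R]_3 := col ord0 1%:M.

Definition crease_x : 'cV[R]_3 := col ord0 (arc alpha).

Definition crease_y (rx : R) : 'cV[R]_3 :=
  col ord0 (arc alpha *m turn rx *m arc beta).

Definition crease_z (rx ry : R) : 'cV[R]_3 :=
  col ord0 (arc alpha *m turn rx *m arc beta *m turn ry *m arc gamma).

(* Simple folds about one line: two opposite creases are collinear, and the
   other two folding angles do not change. *)
Definition simple_folds_xz (B : set (config R)) : Prop :=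
  (forall rx ry rz rw,
     B (half_tan rx, half_tan ry, half_tan rz, half_tan rw) ->
     exists c : R, crease_z rx ry = c *: crease_x) /\
  (exists y0 w0, forall x y z w, B (x, y, z, w) -> y = y0 /\ w = w0).

Definition simple_folds_yw (B : set (config R)) : Prop :=
  (forall rx ry rz rw,
     B (half_tan rx, half_tan ry, half_tan rz, half_tan rw) ->
     exists c : R, crease_y rx = c *: crease_w) /\
  (exists x0 z0, forall x y z w, B (x, y, z, w) -> x = x0 /\ z = z0).

End SectorAngles.

(* The smooth structure of Rhat R = R / 2 pi: the point tan (rho / 2) is sent to
   (cos rho, sin rho), by inverse stereographic projection. *)
Definition embed_hat (x : Rhat R) : R * R :=
  if x is Some t then ((1 - t ^+ 2) / (1 + t ^+ 2), 2 * t / (1 + t ^+ 2))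
  else (-1, 0).

Definition embed (q : config R) : (R * R) * (R * R) * (R * R) * (R * R) :=
  let: (x, y, z, w) := q in
  (embed_hat x, embed_hat y, embed_hat z, embed_hat w).

Definition diffeomorphic_to_circle (B : set (config R)) : Prop :=
  diffeomorphic (embed @` B) (@circle R).

End Linkage.

(* Main.v *)
(* Write M(x, y) for the product of the first four factors of the closed chain,
   arc, turn, arc, turn.  The chain closes iff M(x, y) M(z, w) = 1, that is, as
   M is orthogonal, iff M(x, y) is the transpose of M(z, w).  For sector angles
   pi / 2 the entries of this equation are monomials in sines and cosines; one
   of them reads sin rho_x sin rho_y = 0, which leaves the four cases
   cos rho_y = 1, cos rho_x = 1, cos rho_y = -1, cos rho_x = -1, and in each of
   them the remaining entries say exactly that the configuration lies on one
   of the four circles. *)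
Require Import Defs.
From mathcomp Require Import all_boot all_order all_algebra.
From mathcomp Require Import all_classical all_reals all_analysis.
From mathcomp Require Import ring lra.
Import Order.TTheory GRing.Theory Num.Theory.
Import numFieldNormedType.Exports.
Local Open Scope classical_set_scope.
Local Open Scope ring_scope.

(** * Half-angle tangents and stereographic projection of the circle *)

Section HalfTangent.
Context {R : realType}.
Implicit Types (r s t : R) (x : Rhat R).

Lemma half_tan0 : half_tan (0 : R) = fin 0.
Proof. by rewrite /half_tan mul0r cos0 oner_eq0 tan0. Qed.

Lemma half_tanpi : half_tan (pi : R) = infty.
Proof. by rewrite /half_tan cos_pihalf eqxx. Qed.

Lemma half_tanN r : half_tan (- r) = opp_hat (half_tan r).
Proof. by rewrite /half_tan mulNr cosN tanN; case: ifP. Qed.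

Lemma double_half r : (r *+ 2) / 2 = r.
Proof. by field. Qed.

Lemma half_tan_surj x : exists r, half_tan r = x.
Proof.
case: x => [t|]; last by exists pi; exact: half_tanpi.
exists (atan t *+ 2); rewrite /half_tan double_half.
by rewrite gt_eqF ?atanK// cos_gt0_pihalf// atan_gtNpi2 atan_ltpi2.
Qed.

Lemma one_add_sqr_neq0 t : 1 + t ^+ 2 != 0.
Proof. by rewrite gt_eqF// ltr_pwDl// sqr_ge0. Qed.

(** The double-angle formulas for [u = r / 2], with [1 + tan u ^+ 2] the inverse of [cos u ^+ 2];
    when [cos u = 0] the angle is an odd multiple of pi, sent to [(-1, 0)]. Equations between
    half-angle tangents thus become equations between cosines and sines. *)
Lemma embed_half_tan r : embed_hat (half_tan r) = (cos r, sin r).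
Proof.
have -> : r = (r / 2) *+ 2 by field.
rewrite /half_tan double_half cos_mulr2n sin_mulr2n; set u := r / 2.
case: ifPn => [/eqP cu0|cu0] /=.
  by rewrite cu0 mul0r expr0n/= !mul0rn sub0r.
have h := cos2Dsin2 u.
have -> : 1 + tan u ^+ 2 = (cos u ^+ 2)^-1 by rewrite -cos2_tan2.
rewrite /tan !invrK; congr pair; last by field.
by rewrite mulrBl mul1r expr_div_n divfK ?expf_neq0//; lra.
Qed.

(** Stereographic projection from [(-1, 0)] recovers a finite [t] as [s / (1 + c)]; no finite [t]
    reaches the centre, as [c + 1 = 2 / (1 + t ^+ 2)] is nonzero. *)
Lemma embed_hat_inj : injective (@embed_hat R).
Proof.
have finN t : embed_hat (fin t) <> embed_hat infty.
  move=> [/eqP]; rewrite -subr_eq0 opprK.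
  have h := one_add_sqr_neq0 t.
  have -> : (1 - t ^+ 2) / (1 + t ^+ 2) + 1 = 2 / (1 + t ^+ 2) by field.
  by rewrite mulf_eq0 invr_eq0 (negbTE h) pnatr_eq0.
have finE t : (embed_hat (fin t)).2 / (1 + (embed_hat (fin t)).1) = t.
  have h := one_add_sqr_neq0 t; rewrite /=; field.
  by rewrite h addrCA addrK (_ : 1 + 1 = 2%:R)// pnatr_eq0.
case=> [s|] [t|]//.
- by move=> e; congr Some; rewrite -[s]finE -[t]finE /fin e.
- by move/finN.
- by move/esym/finN.
Qed.

Lemma eq_half_tan r s : cos r = cos s -> sin r = sin s ->
  half_tan r = half_tan s.
Proof. by move=> cE sE; apply: embed_hat_inj; rewrite !embed_half_tan cE sE. Qed.

(** Tangent 0, like tangent infinity below, forces a folding angle in pi times the integers; the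
    vanishing sine is what later makes opposite creases collinear. *)
Lemma half_tan_fin0 r : half_tan r = fin 0 -> sin r = 0.
Proof.
move=> h; have := embed_half_tan r; rewrite h /= => -[_ <-].
by rewrite mulr0 mul0r.
Qed.

Lemma half_tan_infty r : half_tan r = infty -> sin r = 0.
Proof. by move=> h; have := embed_half_tan r; rewrite h /= => -[_ <-]. Qed.

Lemma range_embed_hat : range (@embed_hat R) = circle.
Proof.
apply/seteqP; split => [_ [x _ <-]|[c s] /= cs].
  by have [r <-] := half_tan_surj x; rewrite embed_half_tan /circle/= cos2Dsin2.
(* The centre of projection [(-1, 0)] is the image of infinity; any other point comes from
   [s / (1 + c)], the half-angle formula for the tangent. *)
have [c1|c1] := eqVneq (1 + c) 0.
  exists infty => //=; have cE : c = -1 by lra.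
  congr pair; first by rewrite cE.
  have /eqP : s ^+ 2 = 0 by move: cs; rewrite /circle/= cE sqrrN expr1n; lra.
  by rewrite sqrf_eq0 => /eqP.
exists (fin (s / (1 + c))) => //=.
have sE : s ^+ 2 = (1 - c) * (1 + c) by move: cs; rewrite /circle/=; lra.
have -> : (s / (1 + c)) ^+ 2 = (1 - c) / (1 + c).
  by rewrite expr_div_n sE; field.
have e : 1 + (1 - c) / (1 + c) = 2 / (1 + c) by field.
by rewrite e; congr pair; field; rewrite c1.
Qed.

End HalfTangent.

(** * Matrix form of the closing condition for right angles *)

Section Chain.
Context {R : realType}.
Implicit Types rx ry rz rw : R.

(** Has the shape of the bodies of [arc] and [turn], so that these fold to it and their products can
    be computed entry by entry. *)
Definition mx3 (s : seq (seq R)) : 'M[R]_3 :=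
  \matrix_(i, j) nth 0 (nth [::] s i) j.

Lemma mulmx3 (a b c d e f g h i a' b' c' d' e' f' g' h' i' : R) :
  mx3 [:: [:: a; b; c]; [:: d; e; f]; [:: g; h; i]] *m
  mx3 [:: [:: a'; b'; c']; [:: d'; e'; f']; [:: g'; h'; i']] =
  mx3 [:: [:: a * a' + b * d' + c * g'; a * b' + b * e' + c * h';
              a * c' + b * f' + c * i'];
          [:: d * a' + e * d' + f * g'; d * b' + e * e' + f * h';
              d * c' + e * f' + f * i'];
          [:: g * a' + h * d' + i * g'; g * b' + h * e' + i * h';
              g * c' + h * f' + i * i']].
Proof.
apply/matrixP => -[[|[|[|//]]] ?] [[|[|[|//]]] ?];
  by rewrite !mxE !big_ord_recr big_ord0 /= !mxE /= add0r.
Qed.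

Lemma mx3_inj (a b c d e f g h i a' b' c' d' e' f' g' h' i' : R) :
  mx3 [:: [:: a; b; c]; [:: d; e; f]; [:: g; h; i]] =
  mx3 [:: [:: a'; b'; c']; [:: d'; e'; f']; [:: g'; h'; i']] ->
  [/\ a = a', b = b' & c = c'] /\ [/\ d = d', e = e' & f = f'] /\
  [/\ g = g', h = h' & i = i'].
Proof.
move=> /matrixP E.
pose o (k : nat) (kP : (k < 3)%N) := Ordinal kP.
have H (k l : nat) kP lP := E (o k kP) (o l lP).
by split; [|split]; split; [have := H 0%N 0%N|have := H 0%N 1%N|have := H 0%N 2%N
  |have := H 1%N 0%N|have := H 1%N 1%N|have := H 1%N 2%N
  |have := H 2%N 0%N|have := H 2%N 1%N|have := H 2%N 2%N] => /(_ isT isT); rewrite !mxE.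
Qed.

Lemma mx3_tr (a b c d e f g h i : R) :
  (mx3 [:: [:: a; b; c]; [:: d; e; f]; [:: g; h; i]])^T =
  mx3 [:: [:: a; d; g]; [:: b; e; h]; [:: c; f; i]].
Proof.
by apply/matrixP => -[[|[|[|//]]] ?] [[|[|[|//]]] ?]; rewrite !mxE.
Qed.

Lemma mx3_1 : 1%:M = mx3 [:: [:: 1; 0; 0]; [:: 0; 1; 0]; [:: 0; 0; 1]].
Proof.
by apply/matrixP => -[[|[|[|//]]] ?] [[|[|[|//]]] ?]; rewrite !mxE.
Qed.

Lemma arc_pihalf :
  Defs.arc (pi / 2) = mx3 [:: [:: 0; -1; 0]; [:: 1; 0; 0]; [:: 0; 0; 1]].
Proof. by rewrite /Defs.arc cos_pihalf sin_pihalf. Qed.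

Definition half_chain rx ry : 'M[R]_3 :=
  Defs.arc (pi / 2) *m turn rx *m Defs.arc (pi / 2) *m turn ry.

Lemma half_chainE rx ry : half_chain rx ry =
  mx3 [:: [:: - cos rx; sin rx * sin ry; sin rx * cos ry];
          [:: 0; - cos ry; sin ry];
          [:: sin rx; cos rx * sin ry; cos rx * cos ry]].
Proof.
rewrite /half_chain arc_pihalf /turn -!/(mx3 _) !mulmx3.
by congr mx3; congr [:: [:: _; _; _]; [:: _; _; _]; [:: _; _; _]]; ring.
Qed.

Lemma half_chain_orth rx ry : half_chain rx ry *m (half_chain rx ry)^T = 1%:M.
Proof.
rewrite half_chainE mx3_tr mulmx3 mx3_1.
have cx := sin2cos2 rx; have cy := sin2cos2 ry.
by congr mx3; congr [:: [:: _; _; _]; [:: _; _; _]; [:: _; _; _]]; ring: cx cy.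
Qed.

(** As the sector angles are equal, the last four factors of the chain are again a half chain, now
    in [rz] and [rw]. Its transpose is its inverse on both sides, a right inverse of a square matrix
    being a left inverse. *)
Lemma square_closedP rx ry rz rw :
  closed_chain (pi / 2) (pi / 2) (pi / 2) (pi / 2) rx ry rz rw <->
  half_chain rx ry = (half_chain rz rw)^T.
Proof.
have -> : closed_chain (pi / 2) (pi / 2) (pi / 2) (pi / 2) rx ry rz rw =
    (half_chain rx ry *m half_chain rz rw = 1%:M).
  by rewrite /closed_chain /half_chain !mulmxA.
split=> [e|->]; last exact/mulmx1C/half_chain_orth.
by rewrite -[LHS]mulmx1 -(half_chain_orth rz rw) mulmxA e mul1mx.
Qed.

End Chain.

(** * Smoothness of maps with constant differential *)

Section Smoothness.
Context {R : realType}.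

Lemma Ck_on_cst {V W : normedModType R} (a : W) k (U : set V) :
  Ck_on k U (cst a).
Proof.
elim: k a => [|k IH] a /=; first by move=> p _; exact: cst_continuous.
split => [p _|v]; first exact: differentiable_cst.
rewrite (_ : (fun p => _) = cst 0)//; apply/funext => p.
by rewrite deriveE ?diff_cst//; exact: differentiable_cst.
Qed.

(** If the differential is the same at every point, each directional derivative is a constant
    function, and constants are of every class. This covers all the maps needed, which are
    affine. *)
Lemma Ck_on_constant_diff {V W : normedModType R} (f df : V -> W) :
  (forall p, is_diff p f df) -> forall k U, Ck_on k U f.
Proof.
move=> fE [|k] U /=.
  by move=> p _; exact/differentiable_continuous/(@ex_diff _ _ _ _ _ _ _ (fE p)).
split => [p _|v]; first exact: (@ex_diff _ _ _ _ _ _ _ (fE p)).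
rewrite (_ : (fun p => _) = cst (df v)); first exact: Ck_on_cst.
apply/funext => p; have h := fE p.
by rewrite deriveE ?diff_val//; exact: ex_diff.
Qed.

Lemma smooth_on_constant_diff {V W : normedModType R} (f df : V -> W) X :
  (forall p, is_diff p f df) -> smooth_on X f.
Proof.
move=> fE p _; exists setT, f; split => //; first exact: openT.
by move=> k; exact: Ck_on_constant_diff fE k _.
Qed.

Lemma is_diff_fst {V W : normedModType R} (p : V * W) : is_diff p fst fst.
Proof.
have fstc : continuous (fst : V * W -> V) by move=> ?; exact: cvg_fst.
apply: DiffDef; first exact: linear_differentiable.
by rewrite diff_lin.
Qed.

Lemma is_diff_snd {V W : normedModType R} (p : V * W) : is_diff p snd snd.
Proof.
have sndc : continuous (snd : V * W -> W) by move=> ?; exact: cvg_snd.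
apply: DiffDef; first exact: linear_differentiable.
by rewrite diff_lin.
Qed.

End Smoothness.

(** * Closures in the one-point compactification *)

Section Topology.
Context {R : realType}.

Lemma Rhat_hausdorff : hausdorff_space (Rhat R).
Proof.
apply: one_point_compactification_hausdorff; first exact: locally_compactR.
exact: Rhausdorff.
Qed.

Lemma fin_dense (x : Rhat R) U : nbhs x U -> exists t, U (fin t).
Proof.
case: x => [t|]; first by move=> /nbhs_singleton; exists t.
case=> K [cK _] KU.
(* A neighbourhood of infinity contains the complement of a compact [K]; all of [K] has norm at most
   [|M| + 1], so [|M| + 2] lies outside it. *)
have [M [_ /(_ (`|M| + 1)) KM]] := compact_bounded cK.
exists (`|M| + 2); apply: KU; left; exists (`|M| + 2) => // KM2.
have := KM _ _ KM2; rewrite /= (ltr_pwDr _ (ler_norm _))// => /(_ isT).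
by rewrite (ger0_norm)//; have := normr_ge0 M; lra.
Qed.

(* A Hausdorff codomain makes the coincidence set closed. *)
Lemma closure_eq_image {T : topologicalType} (A : set T) (u v : T -> Rhat R) p :
  continuous u -> continuous v -> (forall a, A a -> u a = v a) ->
  closure A p -> u p = v p.
Proof.
move=> cu cv uv clp; apply: Rhat_hausdorff => U V Uup Vvp.
have Up : nbhs p (u @^-1` U) := cu p U Uup.
have Vp : nbhs p (v @^-1` V) := cv p V Vvp.
have [a [Aa [Ua Va]]] := clp _ (filterI Up Vp).
by exists (u a); split => //; rewrite uv.
Qed.

Lemma closure_range_fin {T : topologicalType} (c : Rhat R -> T) x :
  continuous c -> closure (range (fun t : R => c (fin t))) (c x).
Proof.
move=> cc U /cc /fin_dense[t Ut].
by exists (c (fin t)); split=> //; exists t.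
Qed.

End Topology.

(** * Continuity of pairings and of the four coordinates *)

Lemma continuous_pair {S T U : topologicalType} {f : S -> T} {g : S -> U} :
  continuous f -> continuous g -> continuous (fun x => (f x, g x)).
Proof. by move=> cf cg x; apply: cvg_pair; [exact: cf|exact: cg]. Qed.

Section Projections.
Context {A B C D : topologicalType}.

Lemma continuous_proj1 : continuous (fun q : A * B * C * D => q.1.1.1).
Proof.
move=> q; apply: (@continuous_comp _ _ _ (fst \o fst) fst); last exact: cvg_fst.
by apply: continuous_comp; exact: cvg_fst.
Qed.

Lemma continuous_proj2 : continuous (fun q : A * B * C * D => q.1.1.2).
Proof.
move=> q; apply: (@continuous_comp _ _ _ (fst \o fst) snd); last exact: cvg_snd.
by apply: continuous_comp; exact: cvg_fst.
Qed.

Lemma continuous_proj3 : continuous (fun q : A * B * C * D => q.1.2).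
Proof.
by move=> q; apply: (@continuous_comp _ _ _ fst snd); [exact: cvg_fst|exact: cvg_snd].
Qed.

Lemma continuous_proj4 : continuous (fun q : A * B * C * D => q.2).
Proof. by move=> q; exact: cvg_snd. Qed.

End Projections.

(** * The four circles of solutions of the square *)

Section Branches.
Context {R : realType}.
Local Notation right_angle := (pi / 2 : R).

Lemma sin0_cos r : sin r = 0 :> R -> cos r = 1 \/ cos r = -1.
Proof.
move=> s0; have /eqP := cos2Dsin2 r; rewrite s0 expr0n addr0 sqrf_eq1.
by case/orP => /eqP; [left|right].
Qed.

Lemma half_chain_eq_tr (rx ry rz rw : R) :
  half_chain rx ry = (half_chain rz rw)^T ->
  [\/ [/\ cos ry = 1 /\ sin ry = 0, cos rw = 1 /\ sin rw = 0 &
          cos rz = cos rx /\ sin rz = sin rx],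
      [/\ cos rx = 1 /\ sin rx = 0, cos rz = 1 /\ sin rz = 0 &
          cos rw = cos ry /\ sin rw = sin ry],
      [/\ cos ry = -1 /\ sin ry = 0, cos rw = -1 /\ sin rw = 0 &
          cos rz = cos rx /\ sin rz = - sin rx] |
      [/\ cos rx = -1 /\ sin rx = 0, cos rz = -1 /\ sin rz = 0 &
          cos rw = cos ry /\ sin rw = - sin ry]].
Proof.
(* The entries used give [cos rx = cos rz], [sin rx * sin ry = 0], [sin rx * cos ry = sin rz],
   [cos ry = cos rw] and [cos rx * sin ry = sin rw]. Once one sine vanishes, its cosine is 1 or -1,
   and this sign decides between equal and opposite folding angles. *)
rewrite !half_chainE mx3_tr => /mx3_inj[[cxz /eqP ss szE] [[_ cyw _] [_ swE _]]].
have cz : cos rz = cos rx by lra.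
have cw : cos rw = cos ry by lra.
move: ss; rewrite mulf_eq0 => /orP[] /eqP s0.
- have sz0 : sin rz = 0 by rewrite -szE s0 mul0r.
  case: (sin0_cos _ s0) => c1; move: swE; rewrite c1.
  + by rewrite mul1r => sw; constructor 2; do !split; rewrite ?cz.
  + by rewrite mulN1r => sw; constructor 4; do !split; rewrite ?cz.
- have sw0 : sin rw = 0 by rewrite -swE s0 mulr0.
  case: (sin0_cos _ s0) => c1; move: szE; rewrite c1.
  + by rewrite mulr1 => sz; constructor 1; do !split; rewrite ?cw.
  + by rewrite mulrN1 => sz; constructor 3; do !split; rewrite ?cw.
Qed.

Lemma square_solutionsP (q : config R) :
  solutions right_angle right_angle right_angle right_angle q <->
  exists t : Rhat R,
    [\/ q = (t, fin 0, t, fin 0), q = (fin 0, t, fin 0, t),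
        q = (t, infty, opp_hat t, infty) | q = (infty, t, infty, opp_hat t)].
Proof.
split.
  move=> [rx [ry [rz [rw [/square_closedP/half_chain_eq_tr H ->]]]]].
  have H0 r : cos r = 1 /\ sin r = 0 -> half_tan r = fin 0 :> Rhat R.
    by move=> [c s]; rewrite -half_tan0; apply: eq_half_tan;
      rewrite ?cos0 ?sin0.
  have Hpi r : cos r = -1 /\ sin r = 0 -> half_tan r = infty :> Rhat R.
    by move=> [c s]; rewrite -half_tanpi; apply: eq_half_tan;
      rewrite ?cospi ?sinpi.
  have HN (r s : R) : cos s = cos r /\ sin s = - sin r ->
      half_tan s = opp_hat (half_tan r).
    by move=> [c e]; rewrite -half_tanN; apply: eq_half_tan;
      rewrite ?cosN ?sinN.
  case: H => -[].
  - move=> /H0 -> /H0 -> [c s]; rewrite (eq_half_tan _ _ c s).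
    by exists (half_tan rx); constructor 1.
  - move=> /H0 -> /H0 -> [c s]; rewrite (eq_half_tan _ _ c s).
    by exists (half_tan ry); constructor 2.
  - move=> /Hpi -> /Hpi -> /HN ->.
    by exists (half_tan rx); constructor 3.
  - move=> /Hpi -> /Hpi -> /HN ->.
    by exists (half_tan ry); constructor 4.
(* Conversely, a folding angle [r] with tangent [t] is chosen; the fixed angles are 0 or pi, and pi
   goes with the opposite angle [- r]. *)
move=> [t]; have [r <-] := half_tan_surj t.
have chain_eq := fun rx ry rz rw => (square_closedP rx ry rz rw).2.
case=> ->.
- exists r, 0, r, 0; rewrite half_tan0; split => //; apply: chain_eq.
  rewrite !half_chainE mx3_tr cos0 sin0.
  by congr mx3; congr [:: [:: _; _; _]; [:: _; _; _]; [:: _; _; _]]; ring.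
- exists 0, r, 0, r; rewrite half_tan0; split => //; apply: chain_eq.
  rewrite !half_chainE mx3_tr cos0 sin0.
  by congr mx3; congr [:: [:: _; _; _]; [:: _; _; _]; [:: _; _; _]]; ring.
- exists r, pi, (- r), pi; rewrite half_tanpi half_tanN; split => //.
  apply: chain_eq; rewrite !half_chainE mx3_tr cosN sinN cospi sinpi.
  by congr mx3; congr [:: [:: _; _; _]; [:: _; _; _]; [:: _; _; _]]; ring.
- exists pi, r, pi, (- r); rewrite half_tanpi half_tanN; split => //.
  apply: chain_eq; rewrite !half_chainE mx3_tr cosN sinN cospi sinpi.
  by congr mx3; congr [:: [:: _; _; _]; [:: _; _; _]; [:: _; _; _]]; ring.
Qed.

(** * Creases of the square and their collinearity *)

Lemma square_crease_x : crease_x right_angle = \col_i nth 0 [:: 0; 1; 0] i.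
Proof.
rewrite /crease_x arc_pihalf; apply/matrixP => -[[|[|[|//]]] ?] j;
by rewrite !mxE.
Qed.

Lemma square_crease_y (rx : R) : crease_y right_angle right_angle rx =
  \col_i nth 0 [:: - cos rx; 0; sin rx] i.
Proof.
rewrite /crease_y arc_pihalf /turn -!/(mx3 _) !mulmx3.
by apply/matrixP => -[[|[|[|//]]] ?] j; rewrite !mxE/=; ring.
Qed.

(** The first column of a quarter-turn [arc] is the second basis vector, so this crease is the
    second column of [half_chain rx ry]. *)
Lemma square_crease_z (rx ry : R) :
  crease_z right_angle right_angle right_angle rx ry =
  \col_i nth 0 [:: sin rx * sin ry; - cos ry; cos rx * sin ry] i.
Proof.
rewrite /crease_z -/(half_chain rx ry) half_chainE arc_pihalf mulmx3.
by apply/matrixP => -[[|[|[|//]]] ?] j; rewrite !mxE/=; ring.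
Qed.

(** When [sin ry = 0], the first and third coordinates of [crease_z] vanish, leaving [- cos ry]
    times [crease_x]. The condition on [y0] holds both for [fin 0] and for [infty]. *)
Lemma square_simple_folds_xz (B : set (config R)) y0 w0 :
  (forall r, half_tan r = y0 -> sin r = 0) ->
  (forall x y z w, B (x, y, z, w) -> y = y0 /\ w = w0) ->
  simple_folds_xz right_angle right_angle right_angle B.
Proof.
move=> y0E BE; split; last by exists y0, w0.
move=> rx ry rz rw /BE[/y0E sy _]; exists (- cos ry).
rewrite square_crease_z square_crease_x sy !mulr0.
by apply/matrixP => -[[|[|[|//]]] ?] j; rewrite !mxE/=; ring.
Qed.

Lemma square_simple_folds_yw (B : set (config R)) x0 z0 :
  (forall r, half_tan r = x0 -> sin r = 0) ->
  (forall x y z w, B (x, y, z, w) -> x = x0 /\ z = z0) ->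
  simple_folds_yw right_angle right_angle B.
Proof.
move=> x0E BE; split; last by exists x0, z0.
move=> rx ry rz rw /BE[/x0E sx _]; exists (- cos rx).
rewrite square_crease_y /crease_w mx3_1 sx.
by apply/matrixP => -[[|[|[|//]]] ?] j; rewrite !mxE/=; ring.
Qed.

(** * Diffeomorphisms between the branches and the circle *)

Local Notation space8 := ((R * R) * (R * R) * (R * R) * (R * R))%type.

(* Each embedded branch is the graph of an affine map over one of its
   circle factors; the diffeomorphisms are that map and the projection. *)
Lemma diffeomorphic_to_circle_range (c : Rhat R -> config R)
    (g dg : R * R -> space8) (f df : space8 -> R * R) :
  (forall x, embed (c x) = g (embed_hat x)) ->
  (forall p, is_diff p g dg) -> (forall q, is_diff q f df) -> cancel g f ->
  diffeomorphic_to_circle (range c).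
Proof.
move=> cE gE fE gK.
have imE : embed @` range c = g @` circle.
  by rewrite -range_embed_hat !image_comp; apply: eq_imagel => x _ /=.
rewrite /diffeomorphic_to_circle imE; exists f, g; split.
- by split; [exact: smooth_on_constant_diff fE|exact: smooth_on_constant_diff gE].
- by move=> _ [p cp <-]; rewrite gK.
- by move=> q cq; exists q.
- by move=> q /set_mem[p _ <-]; rewrite gK.
- by move=> p _; rewrite gK.
Qed.

(** Negating the tangent negates the folding angle, which reflects the circle in its first axis. *)
Lemma embed_hat_opp (x : Rhat R) :
  embed_hat (opp_hat x) = ((embed_hat x).1, - (embed_hat x).2).
Proof.
by case: x => [t|] /=; rewrite ?oppr0 ?sqrrN ?mulrN ?mulNr.
Qed.

Lemma embed_hat0 : embed_hat (fin 0) = (1, 0) :> R * R.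
Proof. by rewrite /= expr0n mulr0 mul0r subr0 addr0 divr1. Qed.

Lemma is_diff_proj1 (q : space8) :
  is_diff q (fun q => q.1.1.1) (fun q => q.1.1.1).
Proof.
exact: (is_diff_comp (is_diff_comp (is_diff_fst _) (is_diff_fst _))
  (is_diff_fst _)).
Qed.

Lemma is_diff_proj2 (q : space8) :
  is_diff q (fun q => q.1.1.2) (fun q => q.1.1.2).
Proof.
exact: (is_diff_comp (is_diff_comp (is_diff_fst _) (is_diff_fst _))
  (is_diff_snd _)).
Qed.

Lemma is_diff_reflect (p : R * R) :
  is_diff p (fun p => (p.1, - p.2)) (fun p => (p.1, - p.2)).
Proof. exact: is_diff_pair (is_diff_fst _) (is_diffN (is_diff_snd _)). Qed.

(** On the circle, [h] acts as the map [k] with constant differential: the identity for the finite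
    branches, the reflection for those at infinity. The branch embeds as the graph
    [p -> (p, c, k p, c)], inverted by the first projection. *)
Lemma diffeomorphic_to_circle_xz (c : Rhat R) (h : Rhat R -> Rhat R)
    (k dk : R * R -> R * R) :
  (forall x, embed_hat (h x) = k (embed_hat x)) ->
  (forall p, is_diff p k dk) ->
  diffeomorphic_to_circle (range (fun x => (x, c, h x, c))).
Proof.
move=> hk kE; have cE (p : R * R) := is_diff_cst (embed_hat c) p.
have gE (p : R * R) := is_diff_pair (is_diff_pair (is_diff_pair (is_diff_id p) (cE p))
  (kE p)) (cE p).
apply: (diffeomorphic_to_circle_range _ _ _ _ _ _ gE is_diff_proj1) => // x.
by rewrite /embed hk.
Qed.

Lemma diffeomorphic_to_circle_yw (c : Rhat R) (h : Rhat R -> Rhat R)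
    (k dk : R * R -> R * R) :
  (forall x, embed_hat (h x) = k (embed_hat x)) ->
  (forall p, is_diff p k dk) ->
  diffeomorphic_to_circle (range (fun y => (c, y, c, h y))).
Proof.
move=> hk kE; have cE (p : R * R) := is_diff_cst (embed_hat c) p.
have gE (p : R * R) := is_diff_pair (is_diff_pair (is_diff_pair (cE p) (is_diff_id p))
  (cE p)) (kE p).
apply: (diffeomorphic_to_circle_range _ _ _ _ _ _ gE is_diff_proj2) => // x.
by rewrite /embed hk.
Qed.

(** * Completion of the finite branches *)

Lemma closure_xz :
  closure (range (fun x : R => (fin x, fin 0, fin x, fin 0)) : set (config R)) =
  range (fun x : Rhat R => (x, fin 0, x, fin 0)).
Proof.
apply/seteqP; split => [[[[x y] z] w] Fq|_ [x _ <-]]; last first.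
  (* The parametrization is continuous on the whole compactified line, in which the finite points
     are dense. *)
  apply: (closure_range_fin (fun x => (x, fin 0, x, fin 0))).
  have ci : continuous (fun x : Rhat R => x) by move=> ?; exact: cvg_id.
  have cc : continuous (fun _ : Rhat R => fin 0 : Rhat R).
    exact: cst_continuous.
  by apply: continuous_pair (continuous_pair (continuous_pair ci cc) ci) cc.
(* The equations [y = 0], [w = 0] and [x = z] hold on the finite branch and pass to its closure,
   since both sides are continuous with values in a Hausdorff space. *)
have yE : y = fin 0.
  by apply: (@closure_eq_image R _ _
    (fun q : config R => q.1.1.2) (fun=> fin 0) _
    continuous_proj2 _ _ Fq) => [?|_ [t _ <-]//]; exact: cvg_cst.
have wE : w = fin 0.
  by apply: (@closure_eq_image R _ _
    (fun q : config R => q.2) (fun=> fin 0) _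
    continuous_proj4 _ _ Fq) => [?|_ [t _ <-]//]; exact: cvg_cst.
have zE : x = z.
  by apply: (@closure_eq_image R _ _
    (fun q : config R => q.1.1.1) (fun q : config R => q.1.2) _
    continuous_proj1 continuous_proj3 _ Fq) => _ [t _ <-].
by exists x => //; rewrite yE wE -zE.
Qed.

Lemma closure_yw :
  closure (range (fun y : R => (fin 0, fin y, fin 0, fin y)) : set (config R)) =
  range (fun y : Rhat R => (fin 0, y, fin 0, y)).
Proof.
apply/seteqP; split => [[[[x y] z] w] Fq|_ [y _ <-]]; last first.
  apply: (closure_range_fin (fun y => (fin 0, y, fin 0, y))).
  have ci : continuous (fun y : Rhat R => y) by move=> ?; exact: cvg_id.
  have cc : continuous (fun _ : Rhat R => fin 0 : Rhat R).
    exact: cst_continuous.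
  by apply: continuous_pair (continuous_pair (continuous_pair cc ci) cc) ci.
have xE : x = fin 0.
  by apply: (@closure_eq_image R _ _
    (fun q : config R => q.1.1.1) (fun=> fin 0) _
    continuous_proj1 _ _ Fq) => [?|_ [t _ <-]//]; exact: cvg_cst.
have zE : z = fin 0.
  by apply: (@closure_eq_image R _ _
    (fun q : config R => q.1.2) (fun=> fin 0) _
    continuous_proj3 _ _ Fq) => [?|_ [t _ <-]//]; exact: cvg_cst.
have wE : y = w.
  by apply: (@closure_eq_image R _ _
    (fun q : config R => q.1.1.2) (fun q : config R => q.2) _
    continuous_proj2 continuous_proj4 _ Fq) => _ [t _ <-].
by exists y => //; rewrite xE zE -wE.
Qed.

End Branches.

(** * Finite and infinite solutions of the square linkage *)

Theorem mainTheorem2 (R : realType) :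
  let a : R := pi / 2 in
  let F1 : set (config R) := range (fun x : R => (fin x, fin 0, fin x, fin 0)) in
  let F2 : set (config R) := range (fun y : R => (fin 0, fin y, fin 0, fin y)) in
  let B1 : set (config R) := range (fun x : Rhat R => (x, fin 0, x, fin 0)) in
  let B2 : set (config R) := range (fun y : Rhat R => (fin 0, y, fin 0, y)) in
  let B3 : set (config R) :=
    range (fun x : Rhat R => (x, infty, opp_hat x, infty)) in
  let B4 : set (config R) :=
    range (fun y : Rhat R => (infty, y, infty, opp_hat y)) in
  [/\ finite_solutions a a a a = F1 `|` F2,
      closure F1 = B1 /\ closure F2 = B2,
      B1 <> B2,
      diffeomorphic_to_circle B1 /\ diffeomorphic_to_circle B2 &
      simple_folds_xz a a a B1 /\ simple_folds_yw a a B2]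
  /\
  [/\ solutions_at_infinity a a a a = B3 `|` B4,
      B3 <> B4,
      diffeomorphic_to_circle B3 /\ diffeomorphic_to_circle B4 &
      simple_folds_xz a a a B3 /\ simple_folds_yw a a B4].
Proof.
move=> a F1 F2 B1 B2 B3 B4.
have id_diff (p : R * R) : is_diff p id id by exact: is_diff_id.
split; split.
- apply/seteqP; split.
    move=> q [/square_solutionsP[t]].
    (* Finiteness excludes the two circles with constant coordinates at infinity, and the point
       [t = infty] of the other two. *)
    by case=> -> []; case: t => // t _ _ _ _;
      [left|right]; exists t.
  move=> q [] [t _ <-]; split=> //; apply/square_solutionsP; exists (fin t);
    by [constructor 1|constructor 2].
- by split; [exact: closure_xz|exact: closure_yw].
- move=> B12.
  (* This point of [B1] is not in [B2], where [x] is 0; the circles meet at the unfolded state. *)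
  have : B2 (infty, fin 0, infty, fin 0) by rewrite -B12; exists infty.
  by case.
- split; [apply: diffeomorphic_to_circle_xz id_diff|
          apply: diffeomorphic_to_circle_yw id_diff] => //.
- split.
    by apply: square_simple_folds_xz half_tan_fin0 _ => x y z w [? _ [_ <- _ <-]].
  by apply: square_simple_folds_yw half_tan_fin0 _ => x y z w [? _ [<- _ <- _]].
- apply/seteqP; split.
    move=> q [/square_solutionsP[t]].
    case=> -> inf.
    (* The point at infinity of [B1] is [(infty, 0, infty, 0)], the point [y = 0] of [B4]; likewise
       that of [B2] is the point [x = 0] of [B3]. So completing the finite branches adds no further
       solutions at infinity. *)
    + by case: t inf => [t []//|_]; right; exists (fin 0); rewrite //= oppr0.
    + by case: t inf => [t []//|_]; left; exists (fin 0); rewrite //= oppr0.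
    + by left; exists t.
    + by right; exists t.
  move=> q [] [t _ <-]; split; try by case.
    by apply/square_solutionsP; exists t; constructor 3.
  by apply/square_solutionsP; exists t; constructor 4.
- move=> B34.
  (* A finite [x] is chosen because [B3] and [B4] share the point with all coordinates infinite. *)
  have : B4 (fin 1, infty, fin (-1), infty) by rewrite -B34; exists (fin 1).
  by case.
- by split; [apply: diffeomorphic_to_circle_xz embed_hat_opp is_diff_reflect|
             apply: diffeomorphic_to_circle_yw embed_hat_opp is_diff_reflect].
- split.
    by apply: square_simple_folds_xz half_tan_infty _ => x y z w [? _ [_ <- _ <-]].
  by apply: square_simple_folds_yw half_tan_infty _ => x y z w [? _ [<- _ <- _]].
Qed.
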